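(* Let $f,g$ satisfy the assumptions on the composite problem, let $(t_k),(\alpha_k)$ satisfy the assumptions on the inertial sequence, and let $F=f+g$ satisfy the error bound (all given in the context). Let $\gamma\in(0,1/L]$, let $\zeta>0$, let $\mathcal{C}=\{\mathsf{M}_1,\dots,\mathsf{M}_N\}$ be a finite collection of closed manifolds of $\mathbb{R}^n$, and let $(x_k),(y_k),(u_k)$ be the sequences generated from $x_0$ by the provisionally accelerated proximal gradient algorithm equipped with the test $\mathsf{T}^2$ defined in the context. Then, for any $x^\star\in\operatorname{argmin}_{x\in\mathbb{R}^n}F(x)$, there exists $\mathsf{R}>0$ (independent of the iteration index $n$) such that for all iterations $n\ge 1$ $$F(x_{n+1})-F^\star\le \frac{\|x_0-x^\star\|^2}{2\gamma t_n^2}+\frac{n\,\mathsf{R}}{2\gamma t_n^2}=\mathcal{O}\left(\frac1n\right).$$ Furthermore, if $F$ has a unique minimizer $x^\star$ and, with $u^\star=x^\star-\gamma\nabla f(x^\star)$, the following qualifying condition holds for every $\mathsf{M}\in\mathcal{C}$ such that $x^\star\in\mathsf{M}$: there exists $\varepsilon>0$ such that $\mathrm{prox}_{\gamma g}(u)\in\mathsf{M}$ for all $u\in\mathcal{B}(u^\star,\varepsilon)$; then the sequence $(x_k)$ converges, finite-time identification happens (there is $K_0$ such that for all $k\ge K_0$ and all $\mathsf{M}\in\mathcal{C}$, $x_k\in\mathsf{M}$ if and only if $x^\star\in\mathsf{M}$), and there is a finite $K>0$ (independent of $n$) such that for all $n\ge1$ $$F(x_{n+1})-F^\star\le \frac{\|x_0-x^\star\|^2}{2\gamma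 t_n^2}+\frac{K\,\mathsf{R}}{2\gamma t_n^2}=\mathcal{O}\left(\frac1{n^2}\right).$$
   Context: **Problem.** Minimize $F(x)=f(x)+g(x)$ over $x\in\mathbb{R}^n$ (the dimension $n$ of the space is unrelated to the iteration index $n$). Assumptions on the problem: $f:\mathbb{R}^n\to\mathbb{R}$ is convex and differentiable with $L$-Lipschitz gradient ($L>0$); $g:\mathbb{R}^n\to\mathbb{R}\cup\{+\infty\}$ is proper, convex, lower semi-continuous; $\operatorname{argmin}F\neq\emptyset$, and $F^\star=\min F$. **Operators.** For $\gamma>0$, $\mathrm{prox}_{\gamma g}(u)=\operatorname{argmin}_{w\in\mathbb{R}^n}\{g(w)+\frac1{2\gamma}\|w-u\|^2\}$ and $\mathcal{T}_\gamma(x)=\mathrm{prox}_{\gamma g}(x-\gamma\nabla f(x))$. $\mathcal{B}(u,\varepsilon)$ is the ball of center $u$ and radius $\varepsilon$. **Inertial sequence.** $(t_k)_{k\ge0}$ is a real sequence with $t_0=1$, $t_{k+1}^2-t_{k+1}\le t_k^2$ for all $k\ge 0$, and $t_k\ge Ck$ for some $C>0$ and all $k$. The inertial coefficients are $\alpha_{k+1}=\frac{t_k-1}{t_{k+1}}$ for $k\ge0$ (so $\alpha_1=0$) and they are nonnegative (so $t_k\ge1$ for all $k$). **Error bound.** There exist $\beta>0$ and $p\ge1$ such that $F(x)-F^\star\ge\beta\,\mathrm{dist}(x,\operatorname{argmin}F)^p$ for all $x\in\mathbb{R}^n$. **Manifold.** A manifold of $\mathbb{R}^n$ is an embedded submanifold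 of $\mathbb{R}^n$. **Provisionally accelerated proximal gradient algorithm.** Let $x_0\in\mathbb{R}^n$ and $y_0=x_0$. A test $\mathsf{T}$ returns at each iteration $k\ge1$ a value in $\{0,1\}$ depending on $\{x_\ell\}_{\ell\le k}$ and $\{y_\ell\}_{\ell<k}$. For $k\ge1$, $y_k=x_k+\alpha_k(x_k-x_{k-1})$ if the test returns $1$, and $y_k=x_k$ otherwise. For all $k\ge0$, $u_{k+1}=y_k-\gamma\nabla f(y_k)$ and $x_{k+1}=\mathrm{prox}_{\gamma g}(u_{k+1})$ (that is, $x_{k+1}=\mathcal{T}_\gamma(y_k)$). **Test $\mathsf{T}^2$.** Let $\mathsf{Z}=\{y:\|\mathcal{T}_\gamma(y)-y\|^2\le\zeta\text{ and }F(\mathcal{T}_\gamma(y))\le F(x_0)\}$. At iteration $k\ge 1$, $\mathsf{T}^2$ returns $0$ (no acceleration) if and only if $y_{k-1}\in\mathsf{Z}$ and there is some $\mathsf{M}\in\mathcal{C}$ with $\mathcal{T}_\gamma(x_k)\in\mathsf{M}$ and $\mathcal{T}_\gamma(x_k+\alpha_k(x_k-x_{k-1}))\notin\mathsf{M}$; otherwise it returns $1$.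
   Formalization: The formal theorem additionally assumes that F(x_0) is finite, or p > 1, or all inertial coefficients satisfy α_k ≤ 1; when F(x_0) = +∞, p = 1 and some α_k > 1, the stated O(1/n) bound can fail. *)

(* Defs.v *)
(* Provisionally accelerated proximal gradient method on R^n. *)
From HB Require Import structures.
From mathcomp Require Export all_boot all_order all_algebra.
From mathcomp Require Export all_classical all_reals all_analysis.

Set Implicit Arguments.
Unset Strict Implicit.
Unset Printing Implicit Defensive.

Import Order.TTheory GRing.Theory Num.Theory.
Import numFieldNormedType.Exports.

Local Open Scope classical_set_scope.
Local Open Scope ring_scope.

Section EuclideanSpace.
Variables (R : realType) (n : nat).
Notation V := 'rV[R]_n.

(* The norm `|x| of the library on row vectors is the sup norm; its topology is
   the Euclidean one, so open, closed, limits and differentials are unaffected. *)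
Definition enorm (x : V) : R := Num.sqrt (\sum_(i < n) x 0 i ^+ 2).

Definition eball (x : V) (e : R) : set V := [set y | enorm (y - x) < e].

Definition set_dist (x : V) (A : set V) : R := inf [set enorm (x - a) | a in A].

Definition grad (f : V -> R) (x : V) : V :=
  \row_(i < n) 'D_(delta_mx 0 i) (f : V -> R^o) x.

Definition lipschitz_grad (L : R) (f : V -> R) : Prop :=
  forall x y, enorm (grad f x - grad f y) <= L * enorm (x - y).

(* Here 0 * +oo = 0, so the cases t = 0 and t = 1 hold trivially. *)
Definition econvex (g : V -> \bar R) : Prop :=
  forall x y (t : R), 0 <= t <= 1 ->
    (g (t *: x + (1 - t) *: y)%R <= t%:E * g x + (1 - t)%:E * g y)%E.

(* With values in R `|` {+oo}, not identically +oo. *)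
Definition proper_fun (g : V -> \bar R) : Prop :=
  (forall x, (-oo < g x)%E) /\ exists x, (g x < +oo)%E.

Definition argmin (h : V -> \bar R) : set V :=
  [set x | forall y, (h x <= h y)%E].

Definition composite (f : V -> R) (g : V -> \bar R) (x : V) : \bar R :=
  ((f x)%:E + g x)%E.

(* For g proper, convex and lower semicontinuous and gamma > 0 the argmin is a
   singleton; the default value 0 of xget is then irrelevant. *)
Definition prox (gamma : R) (g : V -> \bar R) (u : V) : V :=
  xget 0 (argmin (fun w => g w + ((2 * gamma)^-1 * enorm (w - u) ^+ 2)%:E)%E).

Definition prox_grad (gamma : R) (f : V -> R) (g : V -> \bar R) (x : V) : V :=
  prox gamma g (x - gamma *: grad f x).

Definition error_bound (F : V -> \bar R) (beta p : R) : Prop :=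
  forall x, ((beta * set_dist x (argmin F) `^ p)%:E <= F x - ereal_inf (range F))%E.

End EuclideanSpace.

Section Submanifold.
Variables (R : realType) (n : nat).

Fixpoint Ck (c k : nat) (U : set 'rV[R]_n) (h : 'rV[R]_n -> 'rV[R]_c) : Prop :=
  if k is k'.+1 then
    (forall x, U x -> differentiable h x) /\
    (forall v, Ck k' U (fun x => 'D_v h x))
  else forall x, U x -> {for x, continuous h}.

(* r = Some k is the class C^k, r = None the class C^oo. *)
Definition of_class (r : option nat) (c : nat) (U : set 'rV[R]_n)
    (h : 'rV[R]_n -> 'rV[R]_c) : Prop :=
  if r is Some k then Ck k U h else forall k, Ck k U h.

(* An embedded submanifold of codimension c is locally the zero set of a map
   into R^c whose differential at the point is onto; c = 0 gives the open
   sets. *)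
Definition submanifold (r : option nat) (M : set 'rV[R]_n) : Prop :=
  exists c : nat, forall x, M x ->
    exists (U : set 'rV[R]_n) (h : 'rV[R]_n -> 'rV[R]_c),
      [/\ open_nbhs x U, of_class r U h,
          (forall y, U y -> (M y <-> h y = 0)) &
          range ('d h x) = setT].

End Submanifold.

Section Algorithm.
Variables (R : realType) (n : nat).
Notation V := 'rV[R]_n.

(* Meaningful for k >= 1. *)
Definition inertia (t : nat -> R) (k : nat) : R := (t k.-1 - 1) / t k.

(* A test maps an iteration k >= 1 and the sequences x, y to a boolean, and may
   read x_l for l <= k and y_l for l < k only; false means no acceleration. *)
Definition history_test := nat -> (nat -> V) -> (nat -> V) -> bool.

(* The entry u 0 is not used. *)
Definition provisional_apg (gamma : R) (f : V -> R) (g : V -> \bar R)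
    (alpha : nat -> R) (T : history_test) (x0 : V) (x y u : nat -> V) : Prop :=
  [/\ x 0%N = x0,
      y 0%N = x0,
      (forall k, y k.+1 = if T k.+1 x y
                          then x k.+1 + alpha k.+1 *: (x k.+1 - x k)
                          else x k.+1),
      (forall k, u k.+1 = y k - gamma *: grad f (y k)) &
      (forall k, x k.+1 = prox gamma g (u k.+1))].

Definition test2_zone (gamma : R) (f : V -> R) (g : V -> \bar R) (zeta : R)
    (x0 : V) : set V :=
  [set y | enorm (prox_grad gamma f g y - y) ^+ 2 <= zeta /\
           (composite f g (prox_grad gamma f g y) <= composite f g x0)%E].

Definition test2 (gamma : R) (f : V -> R) (g : V -> \bar R) (alpha : nat -> R)
    (zeta : R) (N : nat) (M : 'I_N -> set V) : history_test :=
  fun k x y =>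
    ~~ `[< test2_zone gamma f g zeta (x 0%N) (y k.-1) /\
           exists i : 'I_N,
             M i (prox_grad gamma f g (x k)) /\
             ~ M i (prox_grad gamma f g
                      (x k + alpha k *: (x k - x k.-1))) >].

End Algorithm.

(* Main.v *)
(** Write [T] for the proximal gradient map and [c = 1 / (2 gamma)]. The descent
    lemma for [f] and the strong convexity of the prox objective give
    [F (T y) + c |w - T y|^2 <= F w + c |w - y|^2] for all [w]. With [w] on the
    segment from [x_k] to a minimizer [a] of [F], an accelerated step does not
    increase the energy [t_k^2 (F x_(k+1) - min F) + c |z_(k+1) - a|^2], where
    [z_(k+1) = x_k + t_k (x_(k+1) - x_k)]; a step without acceleration replaces
    [z_k] by [x_k]. Since the minimizer [a] may be changed at such a step, its cost
    is at most [c] times the squared distance from [x_k] to the set of minimizers,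
    which the error bound controls when the test refuses the acceleration. This
    gives the first rate. If the minimizer [xs] is unique, the error bound turns
    this rate into convergence of [x_k], hence of [y_k] and of the extrapolated
    points, to [xs]; as [T] is continuous at [xs], the qualifying condition and the
    closedness of the sets [M i] put [T] of each of these points, from some
    iteration on, in exactly the [M i] that contain [xs]. From then on every step
    is accelerated. *)
Require Import Defs.
From mathcomp Require Import all_boot all_order all_algebra.
From mathcomp Require Import all_classical all_reals all_analysis.
From mathcomp Require Import ring lra.

Import Order.TTheory GRing.Theory Num.Theory.
Import numFieldNormedType.Exports.

Local Open Scope classical_set_scope.
Local Open Scope ring_scope.

Set Implicit Arguments.
Unset Strict Implicit.
Unset Printing Implicit Defensive.

(** * Euclidean inner product and norm on row vectors *)

Section EuclideanInner.
Context {R : realType} {n : nat}.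
Implicit Types (a b c : 'rV[R]_n) (k : R).

Definition edot a b : R := \sum_(i < n) a 0 i * b 0 i.

Lemma edotC a b : edot a b = edot b a.
Proof. by apply: eq_bigr => i _; rewrite mulrC. Qed.

Lemma edotDl a b c : edot (a + b) c = edot a c + edot b c.
Proof. by rewrite -big_split; apply: eq_bigr => i _; rewrite mxE mulrDl. Qed.

Lemma edotDr a b c : edot c (a + b) = edot c a + edot c b.
Proof. by rewrite edotC edotDl !(edotC c). Qed.

Lemma edotZl k a b : edot (k *: a) b = k * edot a b.
Proof. by rewrite mulr_sumr; apply: eq_bigr => i _; rewrite mxE mulrA. Qed.

Lemma edotZr k a b : edot a (k *: b) = k * edot a b.
Proof. by rewrite edotC edotZl edotC. Qed.

Lemma edotNl a b : edot (- a) b = - edot a b.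
Proof. by rewrite -scaleN1r edotZl mulN1r. Qed.

Lemma edotNr a b : edot a (- b) = - edot a b.
Proof. by rewrite edotC edotNl edotC. Qed.

Definition edotE := (edotDl, edotDr, edotNl, edotNr, edotZl, edotZr).

Lemma edot_ge0 a : 0 <= edot a a.
Proof. by apply: sumr_ge0 => i _; rewrite -expr2 sqr_ge0. Qed.

Lemma enorm_sqr a : enorm a ^+ 2 = edot a a.
Proof.
rewrite sqr_sqrtr; first by apply: eq_bigr => i _; rewrite expr2.
by apply: sumr_ge0 => i _; rewrite sqr_ge0.
Qed.

Lemma enorm_ge0 a : 0 <= enorm a.
Proof. exact: sqrtr_ge0. Qed.

Lemma enormZ k a : enorm (k *: a) = `|k| * enorm a.
Proof.
apply/eqP; rewrite -(@eqrXn2 _ 2) ?mulr_ge0 ?enorm_ge0//.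
by rewrite exprMn !enorm_sqr !edotE real_normK ?num_real//; apply/eqP; ring.
Qed.

Lemma enormN a : enorm (- a) = enorm a.
Proof. by rewrite -scaleN1r enormZ normrN1 mul1r. Qed.

Lemma enormB a b : enorm (a - b) = enorm (b - a).
Proof. by rewrite -opprB enormN. Qed.

Lemma ler_enorm_sqr a (M : R) : 0 <= M -> edot a a <= M ^+ 2 -> enorm a <= M.
Proof. by move=> M0; rewrite -enorm_sqr ler_pXn2r// nnegrE// enorm_ge0. Qed.

(** Cauchy-Schwarz, from the nonnegativity of the squared norm of
    [enorm b ^+ 2 *: a - edot a b *: b]; the case of zero [b] is split off because a factor
    [enorm b ^+ 2] is cancelled. *)
Lemma edot_le_enorm a b : edot a b <= enorm a * enorm b.
Proof.
have [b0|b0] := eqVneq (enorm b) 0.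
  have bi i : b 0 i = 0.
    have : edot b b == 0 by rewrite -enorm_sqr b0 expr0n.
    rewrite psumr_eq0 => [/allP/(_ i)|j _]; last by rewrite -expr2 sqr_ge0.
    by rewrite mem_index_enum => /(_ isT); rewrite mulf_eq0 orbb => /eqP.
  by rewrite b0 mulr0 /edot big1// => i _; rewrite bi mulr0.
have bp : 0 < enorm b by rewrite lt_def b0 enorm_ge0.
have := edot_ge0 (enorm b ^+ 2 *: a - edot a b *: b).
rewrite !edotE (edotC b a) -!enorm_sqr => H.
have {}H : edot a b ^+ 2 <= (enorm a * enorm b) ^+ 2.
  by rewrite -(ler_pM2l (exprn_gt0 2 bp)); nra.
have ab0 : 0 <= enorm a * enorm b by rewrite mulr_ge0 ?enorm_ge0.
have [h|h] := leP 0 (edot a b); last exact: le_trans (ltW h) _.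
by rewrite -(@ler_pXn2r _ 2) ?nnegrE.
Qed.

Lemma ler_enormD a b : enorm (a + b) <= enorm a + enorm b.
Proof.
apply: ler_enorm_sqr; first by rewrite addr_ge0 ?enorm_ge0.
rewrite !edotE (edotC b a) sqrrD !enorm_sqr.
have := edot_le_enorm a b; lra.
Qed.

Lemma ler_enorm_distD c a b : enorm (a - b) <= enorm (a - c) + enorm (c - b).
Proof. by rewrite -[a - b](subrKA c) ler_enormD. Qed.

Lemma norm_le_enorm a : `|a| <= enorm a.
Proof.
rewrite [leLHS]/Num.norm /= mx_normrE; apply/bigmax_leP; split=> [|[i j] _ /=].
  exact: enorm_ge0.
rewrite ord1 -(@ler_pXn2r _ 2) ?nnegrE ?enorm_ge0// enorm_sqr.
rewrite real_normK ?num_real// /edot (bigD1 j)//= -expr2 lerDl.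
by apply: sumr_ge0 => k _; rewrite -expr2 sqr_ge0.
Qed.

Lemma enorm_le_norm a : enorm a <= n%:R * `|a|.
Proof.
have aj j : `|a 0 j| <= `|a|.
  rewrite [leRHS]/Num.norm /= mx_normrE; apply/bigmax_geP; right.
  by exists (0, j).
apply: ler_enorm_sqr; first by rewrite mulr_ge0.
apply: (@le_trans _ _ (\sum_(i < n) `|a| ^+ 2)).
  by apply: ler_sum => i _; rewrite -expr2 -real_normK ?num_real// ler_pXn2r ?nnegrE.
rewrite sumr_const card_ord -[leLHS]mulr_natl exprMn ler_wpM2r ?exprn_ge0//.
by rewrite -natrX ler_nat; case: (n) => // m; rewrite expnS leq_pmulr.
Qed.

(** The ambient topology comes from the sup norm; equivalence of the two norms lets every limit
    below be handled with [enorm]. *)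
Lemma enorm_cvgP {T : Type} (F : set_system T) {FF : Filter F} (h : T -> 'rV[R]_n) (l : 'rV[R]_n) :
  h @ F --> l <-> forall e, 0 < e -> \forall s \near F, enorm (h s - l) < e.
Proof.
split=> [/cvgrPdist_lt H e e0|H].
  have e1 : 0 < e / n.+1%:R by rewrite divr_gt0.
  apply: filterS (H _ e1) => s /= hs; rewrite enormB.
  apply: le_lt_trans (enorm_le_norm _) _.
  rewrite ltr_pdivlMr// mulrC in hs; apply: le_lt_trans hs.
  by rewrite ler_wpM2r// ler_nat.
apply/cvgrPdist_lt => e e0; apply: filterS (H _ e0) => s /= hs.
by apply: le_lt_trans (norm_le_enorm _) _; rewrite enormB.
Qed.

End EuclideanInner.

(** Replaces the limit in first-order arguments: an inequality along a segment is divided by the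
    step [s], and its quadratic remainder becomes [s * c]. *)
Lemma ler_add_small {R : realFieldType} (a b c : R) :
  (forall s, 0 < s -> s <= 1 -> a <= b + s * c) -> a <= b.
Proof.
move=> H; apply/ler_addgt0Pr => e e0.
have [c0|c0] := leP c 0.
  by apply: le_trans (H 1 _ _) _ => //; lra.
have s0 : 0 < Num.min 1 (e / c) by rewrite lt_min ltr01 divr_gt0.
apply: le_trans (H _ s0 _) _; first by rewrite ge_min lexx.
by rewrite lerD2l -ler_pdivlMr// ge_min lexx orbT.
Qed.

(** * Derivatives along lines and the descent lemma *)

Section SmoothConvex.
Context {R : realType} {n : nat}.
Implicit Types (x y z d : 'rV[R]_n) (f : 'rV[R]_n -> R).

Lemma derive_edot_grad f x d : differentiable (f : 'rV[R]_n -> R^o) x ->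
  'D_d (f : 'rV[R]_n -> R^o) x = edot (grad f x) d.
Proof.
move=> df; rewrite deriveE// {1}(row_sum_delta d) linear_sum /=.
by apply: eq_bigr => i _; rewrite linearZ/= mxE -deriveE// mulrC.
Qed.

Lemma is_derive_line f x d (s : R) :
  differentiable (f : 'rV[R]_n -> R^o) (x + s *: d) ->
  is_derive s 1 (fun r => f (x + r *: d) : R^o) (edot (grad f (x + s *: d)) d).
Proof.
move=> df; have E : (fun h : R => h^-1 *: ((fun r => f (x + r *: d) : R^o) (h *: 1 + s)
    - f (x + s *: d)) : R^o)
  = (fun h : R => h^-1 *: ((f : 'rV[R]_n -> R^o) (h *: d + (x + s *: d))
    - f (x + s *: d))).
  apply/funext => h; congr (_ *: (f _ - _)).
  by rewrite scalerDl [h *: 1]mulr1 addrCA.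
split; first by rewrite /derivable/= E; exact: diff_derivable.
by rewrite -derive_edot_grad// /derive/= E.
Qed.

(** The field [G] is abstract so that the bound applies both to [f] and to its opposite. The mean
    value theorem is applied to [psi], the difference between [f] on the segment and its quadratic
    model; the Lipschitz bound makes its derivative nonpositive. *)
Lemma descent f (G : 'rV[R]_n -> 'rV[R]_n) (L : R) y z :
  (forall x d (s : R),
     is_derive s 1 (fun r => f (x + r *: d) : R^o) (edot (G (x + s *: d)) d)) ->
  (forall a b, enorm (G a - G b) <= L * enorm (a - b)) ->
  f z <= f y + edot (G y) (z - y) + L / 2 * edot (z - y) (z - y).
Proof.
move=> df lipG; set d := z - y; set A := edot (G y) d; set B := L / 2 * edot d d.
pose psi (s : R) : R := f (y + s *: d) - s * A - s ^+ 2 * B.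
pose dpsi s := edot (G (y + s *: d)) d - A - 2 * s * B.
have dpsiP (s : R) : is_derive s 1 psi (dpsi s).
  have := df y d s => ?.
  have ? : is_derive s 1 (fun r : R => r * A) A.
    by apply: is_derive_eq; rewrite scaler0 add0r [LHS]mulr1.
  have ? : is_derive s 1 (fun r : R => r ^+ 2 * B) (2 * s * B).
    by apply: is_derive_eq; rewrite scaler0 add0r /GRing.scale /=; ring.
  exact: is_derive_eq.
have [|s] := @MVT R psi dpsi 0 1 ltr01 (fun s _ => dpsiP s).
  by apply: derivable_within_continuous => s _; case: (dpsiP s).
rewrite in_itv/= => /andP[s0 _]; rewrite subr0 mulr1.
rewrite /psi scale0r addr0 scale1r -/d [y + d]addrC subrK.
suff : dpsi s <= 0 by lra.
have := edot_le_enorm (G (y + s *: d) - G y) d.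
have := lipG (y + s *: d) y; rewrite addrAC subrr add0r enormZ gtr0_norm//.
rewrite edotDl edotNl -/A => lipd CS.
have := ler_wpM2r (enorm_ge0 d) lipd.
by rewrite /dpsi /B -enorm_sqr; lra.
Qed.

End SmoothConvex.

(** * Existence and strong minimality of the proximal point *)

Section Prox.
Context {R : realType} {n : nat}.
Implicit Types (x y z w u a : 'rV[R]_n) (g : 'rV[R]_n -> \bar R).

Lemma proper_fineK g x : proper_fun g -> (g x < +oo)%E -> g x = (fine (g x))%:E.
Proof. by move=> [gN _] gx; rewrite fineK// fin_numElt gN gx. Qed.

Lemma econvex_fine g x y (s : R) : proper_fun g -> econvex g -> 0 <= s <= 1 ->
  (g x < +oo)%E -> (g y < +oo)%E ->
  (g (s *: x + (1 - s) *: y)%R < +oo)%E /\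
  fine (g (s *: x + (1 - s) *: y)) <= s * fine (g x) + (1 - s) * fine (g y).
Proof.
move=> gP gC s01 gx gy; have := gC x y s s01.
rewrite (proper_fineK gP gx) (proper_fineK gP gy) /= => H.
have Hoo := le_lt_trans H (ltry _).
by split=> //; move: H; rewrite {1}(proper_fineK gP Hoo).
Qed.

(** The affine minorant of [g] bounds the objective below, strong convexity makes a minimizing
    sequence Cauchy, and lower semicontinuity shows that its limit attains the infimum. *)
Lemma prox_argmin g (a : 'rV[R]_n) (b gamma : R) u : proper_fun g -> econvex g ->
  lower_semicontinuous g -> 0 < gamma ->
  (forall w, (g w < +oo)%E -> edot a w + b <= fine (g w)) ->
  argmin (fun w => g w + ((2 * gamma)^-1 * enorm (w - u) ^+ 2)%:E)%E
    (prox gamma g u).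
Proof.
move=> gP gC gL gamma0 gaff; apply: xgetPex.
set c := (2 * gamma)^-1; have c0 : 0 < c by rewrite invr_gt0 mulr_gt0.
pose H w := fine (g w) + c * edot (w - u) (w - u).
pose E := [set H w | w in [set w | (g w < +oo)%E]].
have lbE : lbound E (edot a u + b - edot a a / (4 * c)).
  move=> _ [w gw <-]; have := gaff w gw.
  (* Completing the square: this vector vanishes at the minimizer of the affine bound plus the
     quadratic term. *)
  have := edot_ge0 (a + (2 * c) *: (w - u)).
  rewrite !edotE !(edotC _ a) (edotC u w) /H !edotE (edotC u w) => sq lin.
  have c4 : 0 < 4 * c by rewrite mulr_gt0.
  rewrite lerBlDr -lerBlDl ler_pdivlMr//.
  have := ler_wpM2r (ltW c0) lin; lra.
have infE : has_inf E.
  split; last by eexists; exact: lbE.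
  by case: gP => _ [w gw]; exists (H w); exists w.
set m := inf E.
have Hm w : (g w < +oo)%E -> m <= H w.
  by move=> gw; apply: ge_inf; [case: infE | exists w].
have /choice[w wP] (k : nat) : exists w, (g w < +oo)%E /\ H w < m + k.+1%:R^-1.
  by have [|_ [w gw <-]] := @inf_adherent R E k.+1%:R^-1 _ infE; [|exists w].
(* The value of [H] at the midpoint is at least [m], and strong convexity puts it below the average
   by a quarter of the left-hand side. *)
have gap i j (e : R) : H (w i) <= m + e -> H (w j) <= m + e ->
    c * edot (w j - w i) (w j - w i) <= 4 * e.
  move=> Hi Hj.
  have h01 : 0 <= (2^-1 : R) <= 1 by lra.
  have [goo gle] := econvex_fine gP gC h01 (proj1 (wP j)) (proj1 (wP i)).
  have {goo} := Hm _ goo.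
  have -> : 1 - 2^-1 = 2^-1 :> R by lra.
  move: gle Hi Hj; have -> : 1 - 2^-1 = 2^-1 :> R by lra.
  rewrite /H !edotE (edotC u (w i)) (edotC u (w j)) (edotC (w i) (w j)).
  by set X := fine (g (_ + _)); lra.
have Hlt k e : e > 0 -> e^-1 <= k%:R -> H (w k) <= m + e.
  move=> e0 ke; apply: le_trans (ltW (proj2 (wP k))) _.
  rewrite lerD2l invf_ple ?posrE// (le_trans ke)// ler_nat//.
have wc : cvg (w @ \oo).
  apply: cauchy_cvg; apply: cauchy_exP => e e0.
  pose d := c * e ^+ 2 / 8; have d0 : 0 < d by rewrite divr_gt0// mulr_gt0// exprn_gt0.
  pose N := (Num.trunc d^-1).+1.
  have HN k : (N <= k)%N -> H (w k) <= m + d.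
    move=> Nk; apply: Hlt => //; apply: le_trans (_ : N%:R <= _).
      exact/ltW/truncnS_gt.
    by rewrite ler_nat.
  exists (w N); exists N => // k /= Nk.
  rewrite -ball_normE /=; apply: le_lt_trans (norm_le_enorm _) _.
  rewrite -(@ltr_pXn2r _ 2) ?nnegrE ?enorm_ge0 ?ltW// enorm_sqr -(ltr_pM2l c0).
  apply: le_lt_trans (gap _ _ _ (HN _ Nk) (HN _ (leqnn N))) _.
  by have : 0 < c * e ^+ 2 by [rewrite mulr_gt0// exprn_gt0]; rewrite /d; lra.
set l := lim (w @ \oo); have wl : w @ \oo --> l by exact: wc.
have hl : (g l + (c * enorm (l - u) ^+ 2)%:E <= m%:E)%E.
  rewrite leNgt; apply/negP => ml.
  (* A real level strictly below [g l], which may be infinite, but still high enough to contradict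
     [m]; by semicontinuity [g (w k)] stays above it eventually. *)
  have [r [mr rg]] : exists r : R, m < r + c * enorm (l - u) ^+ 2 /\ (r%:E < g l)%E.
    move: ml; case: gP => + _ => /(_ l); case: (g l) => [r||]; last by rewrite ltxx.
      rewrite -EFinD lte_fin => _ mr.
      exists (r - (r + c * enorm (l - u) ^+ 2 - m) / 2); rewrite lte_fin; split; lra.
    by move=> _ _; exists (m + 1 - c * enorm (l - u) ^+ 2); rewrite ltry; split=> //; lra.
  set d := r + c * enorm (l - u) ^+ 2 - m; have d0 : 0 < d by rewrite subr_gt0.
  have [V Vl Vg] := gL _ _ rg.
  (* The quadratic term at [w k] falls below its value at [l] by at most [2 * c * enorm (l - u)]
     times the distance of the two points; the added 1 keeps the divisor positive. *)
  pose K := 2 * c * enorm (l - u) + 1.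
  have K0 : 0 < K by rewrite ltr_wpDl// !mulr_ge0 ?enorm_ge0// ltW.
  have dK : 0 < d / 2 / K by rewrite !divr_gt0.
  have wd := (enorm_cvgP _ _).1 wl _ dK.
  near \oo => k.
  have rk : (r%:E < g (w k))%E by apply: Vg; near: k; exact: wl.
  have kl : enorm (w k - l) < d / 2 / K by near: k; exact: wd.
  have Hk : H (w k) <= m + d / 2.
    apply: Hlt; first lra.
    by near: k; exact: nbhs_infty_ger.
  move: rk; rewrite (proper_fineK gP (proj1 (wP k))) lte_fin => rk.
  have := edot_le_enorm (l - u) (l - w k).
  have sq := edot_ge0 (w k - l); have := ler_wpM2l (ltW c0) sq.
  move: Hk kl; rewrite ltr_pdivlMr// /H /K (enormB (w k)) => Hk kl sqc CS.
  have := ler_wpM2l (ltW c0) CS.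
  have := enorm_ge0 (l - w k).
  move: sqc d0 kl Hk; rewrite /d enorm_sqr !edotE (edotC u l) (edotC u (w k)) (edotC l (w k)).
  by lra.
exists l => v.
have [gv|] := ltP (g v) +oo%E; last first.
  by rewrite leye_eq => /eqP ->; rewrite addye// leey.
apply: le_trans hl _; rewrite (proper_fineK gP gv) -EFinD lee_fin enorm_sqr.
exact: Hm.
Unshelve. all: by end_near. Qed.

Lemma prox_argmin_lty g (gamma : R) u z : proper_fun g ->
  argmin (fun w => g w + ((2 * gamma)^-1 * enorm (w - u) ^+ 2)%:E)%E z ->
  (g z < +oo)%E.
Proof.
move=> gP hz; case: (gP) => _ [v gv]; have := hz v.
rewrite (proper_fineK gP gv) -EFinD; case: (g z) => [r||//]; first by rewrite ltry.
by rewrite addye.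
Qed.

(* The minimality of z, tested on the segment from z to w, yields the extra term
   of strong convexity. *)
Lemma prox_three_point g (gamma : R) u z w : proper_fun g -> econvex g -> 0 < gamma ->
  argmin (fun w => g w + ((2 * gamma)^-1 * enorm (w - u) ^+ 2)%:E)%E z ->
  (g w < +oo)%E ->
  fine (g z) + (2 * gamma)^-1 * (edot (z - u) (z - u) + edot (w - z) (w - z))
  <= fine (g w) + (2 * gamma)^-1 * edot (w - u) (w - u).
Proof.
move=> gP gC gamma0 hz gw; have gz := prox_argmin_lty gP hz.
set c := (2 * gamma)^-1; have c0 : 0 < c by rewrite invr_gt0 mulr_gt0.
have : fine (g z) <= fine (g w) + 2 * c * edot (z - u) (w - z).
  apply: (@ler_add_small _ _ _ (c * edot (w - z) (w - z))) => s s0 s1.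
  have s01 : 0 <= s <= 1 by rewrite ltW.
  have [goo gle] := econvex_fine gP gC s01 gw gz.
  have := hz (s *: w + (1 - s) *: z).
  rewrite (proper_fineK gP goo) {1}(proper_fineK gP gz) -!EFinD lee_fin !enorm_sqr -/c.
  move: gle; set X := fine (g (_ + _)) => gle {}hz.
  rewrite -(ler_pM2l s0); move: hz; rewrite !edotE.
  by rewrite (edotC u w) (edotC u z) (edotC z w); lra.
rewrite !edotE (edotC u w) (edotC u z) (edotC z w); lra.
Qed.

End Prox.

(** * First-order bounds for the smooth part *)

Section ConvexGradient.
Context {R : realType} {n : nat} (f : 'rV[R]_n -> R) (L : R).
Hypothesis f_conv : convex_function [set: convex_lmodType 'rV[R]_n] f.
Hypothesis f_diff : forall x, differentiable (f : 'rV[R]_n -> R^o) x.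
Hypothesis f_lip : lipschitz_grad L f.

Lemma convex_fun_segment (x y : 'rV[R]_n) (s : R) : 0 <= s <= 1 ->
  f (s *: x + (1 - s) *: y) <= s * f x + (1 - s) * f y.
Proof.
move=> /andP[s0 s1].
exact: (f_conv (Itv01 s0 s1) (in_setT (x : convex_lmodType 'rV[R]_n))
  (in_setT (y : convex_lmodType 'rV[R]_n))).
Qed.

Lemma convex_descent (y z : 'rV[R]_n) :
  f z <= f y + edot (grad f y) (z - y) + L / 2 * edot (z - y) (z - y).
Proof. by apply: descent => // x d s; exact: is_derive_line. Qed.

(** [descent] for the opposite of [f] bounds [f] below near [y] up to a quadratic error; comparison
    with convexity on the segment and division by [s] leave an error that vanishes with [s]. *)
Lemma convex_grad_le (y z : 'rV[R]_n) : f y + edot (grad f y) (z - y) <= f z.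
Proof.
apply: (@ler_add_small _ _ _ (L / 2 * edot (z - y) (z - y))) => s s0 s1.
have s01 : 0 <= s <= 1 by rewrite ltW.
have := convex_fun_segment z y s01.
have -> : s *: z + (1 - s) *: y = y + s *: (z - y).
  by apply/rowP => i; rewrite !mxE; ring.
have : - f (y + s *: (z - y)) <=
    - f y - s * edot (grad f y) (z - y) + s * s * (L / 2 * edot (z - y) (z - y)).
  have := @descent _ _ (fun x => - f x) (fun x => - grad f x) L y (y + s *: (z - y)).
  have -> : y + s *: (z - y) - y = s *: (z - y) by rewrite [y + _]addrC addrK.
  rewrite edotZl !edotZr edotNl.
  have -> : forall X Y Z W : R, X <= - Y + s * - Z + W * (s * (s * edot (z - y) (z - y))) =
    (X <= - Y - s * Z + s * s * (W * edot (z - y) (z - y))).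
    by move=> X Y Z W; congr (_ <= _); ring.
  apply=> [x d r|a b]; last by rewrite -opprD enormN; exact: f_lip.
  have ? := is_derive_line (f_diff (x + r *: d)).
  by rewrite edotNl; exact: is_deriveN.
move=> dsc cvx; rewrite -(ler_pM2l s0); lra.
Qed.

End ConvexGradient.

(** * The proximal gradient map *)

Section ProxGrad.
Context {R : realType} {n : nat} (f : 'rV[R]_n -> R) (g : 'rV[R]_n -> \bar R).
Context (L gamma : R).
Hypothesis f_conv : convex_function [set: convex_lmodType 'rV[R]_n] f.
Hypothesis f_diff : forall x, differentiable (f : 'rV[R]_n -> R^o) x.
Hypothesis f_lip : lipschitz_grad L f.
Hypothesis L_gt0 : 0 < L.
Hypothesis g_proper : proper_fun g.
Hypothesis g_conv : econvex g.
Hypothesis g_lsc : lower_semicontinuous g.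
Hypothesis F_argmin : argmin (composite f g) !=set0.
Hypothesis gamma_gt0 : 0 < gamma.
Hypothesis gamma_le : gamma <= 1 / L.

(** The objective as a real number; as [fine] sends infinite values to 0, it is meaningful only
    where [g] is finite. *)
Definition finobj x := f x + fine (g x).

Lemma compositeE x : (g x < +oo)%E -> composite f g x = (finobj x)%:E.
Proof. by move=> gx; rewrite /composite {1}(proper_fineK g_proper gx). Qed.

Lemma composite_lty x : (composite f g x < +oo)%E = (g x < +oo)%E.
Proof. by rewrite /composite; case: (g x) => [r||] /=; rewrite ?ltry. Qed.

Lemma argmin_lty x : argmin (composite f g) x -> (g x < +oo)%E.
Proof.
case: (g_proper) => _ [v gv] xmin; rewrite -composite_lty.
by apply: le_lt_trans (xmin v) _; rewrite composite_lty.
Qed.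

Lemma argmin_finobj_le x w : argmin (composite f g) x -> (g w < +oo)%E ->
  finobj x <= finobj w.
Proof.
move=> xmin gw; have := xmin w.
by rewrite !compositeE//; exact: argmin_lty.
Qed.

Lemma finobj_argmin a b : argmin (composite f g) a -> argmin (composite f g) b ->
  finobj a = finobj b.
Proof. by move=> ha hb; apply/le_anti; rewrite !argmin_finobj_le//; exact: argmin_lty. Qed.

Lemma ereal_inf_argmin a : argmin (composite f g) a ->
  ereal_inf (range (composite f g)) = (finobj a)%:E.
Proof.
move=> ha; rewrite -(compositeE (argmin_lty ha)); apply/le_anti/andP; split.
  by apply: ereal_inf_lbound; exists a.
by apply: le_ereal_inf_tmp => _ [w _ <-]; exact: ha.
Qed.

Lemma finobj_convex x y (s : R) : 0 <= s <= 1 -> (g x < +oo)%E -> (g y < +oo)%E ->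
  (g (s *: x + (1 - s) *: y)%R < +oo)%E /\
  finobj (s *: x + (1 - s) *: y) <= s * finobj x + (1 - s) * finobj y.
Proof.
move=> s01 gx gy; have [goo gle] := econvex_fine g_proper g_conv s01 gx gy.
split=> //; have := convex_fun_segment f_conv x y s01; move: gle; rewrite /finobj; lra.
Qed.

(* First-order optimality of a minimizer of [f + g]; it bounds [g] from below by
   an affine function, whence the existence of the prox. *)
Lemma affine_minorant a w : argmin (composite f g) a -> (g w < +oo)%E ->
  edot (- grad f a) w + (fine (g a) + edot (grad f a) a) <= fine (g w).
Proof.
move=> ha gw; have ga := argmin_lty ha.
suff : fine (g a) <= fine (g w) + edot (grad f a) (w - a).
  by rewrite !edotE; lra.
apply: (@ler_add_small _ _ _ (L / 2 * edot (w - a) (w - a))) => s s0 s1.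
have s01 : 0 <= s <= 1 by rewrite ltW.
have [goo gle] := econvex_fine g_proper g_conv s01 gw ga.
have := argmin_finobj_le ha goo; move: goo gle; rewrite /finobj.
have -> : s *: w + (1 - s) *: a = a + s *: (w - a).
  by apply/rowP => i; rewrite !mxE; ring.
move=> _ gle opt; have := convex_descent f_diff f_lip a (a + s *: (w - a)).
have -> : a + s *: (w - a) - a = s *: (w - a) by rewrite [a + _]addrC addrK.
rewrite edotZl !edotZr => dsc.
rewrite -(ler_pM2l s0); lra.
Qed.

Lemma prox_grad_argmin y (u := y - gamma *: grad f y) :
  argmin (fun w => g w + ((2 * gamma)^-1 * enorm (w - u) ^+ 2)%:E)%E
    (prox_grad gamma f g y).
Proof.
have [a ha] := F_argmin.
by apply: prox_argmin => // w; exact: affine_minorant.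
Qed.

Lemma prox_grad_lty y : (g (prox_grad gamma f g y) < +oo)%E.
Proof. exact: prox_argmin_lty (prox_grad_argmin y). Qed.

(** Sum of the three-point inequality of the prox, the descent lemma at [z] and the gradient
    inequality at [w]. The linear terms cancel, and [gamma <= 1 / L] lets the quadratic error of the
    descent lemma be absorbed. *)
Lemma prox_grad_le y w (z := prox_grad gamma f g y) : (g w < +oo)%E ->
  finobj z + (2 * gamma)^-1 * edot (w - z) (w - z)
  <= finobj w + (2 * gamma)^-1 * edot (w - y) (w - y).
Proof.
move=> gw.
have := prox_three_point g_proper g_conv gamma_gt0 (prox_grad_argmin y) gw.
rewrite -/z; have := convex_descent f_diff f_lip y z.
have := convex_grad_le f_conv f_diff f_lip y w.
set c := (2 * gamma)^-1; have c0 : 0 < c by rewrite invr_gt0 mulr_gt0.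
have cg : c * gamma = 2^-1 by rewrite /c; field; rewrite gt_eqF.
have Lc : L / 2 <= c.
  rewrite /c invfM mulrC ler_wpM2l// -[L]invrK lef_pV2 ?posrE ?invr_gt0//.
  by rewrite -div1r.
have sqz := edot_ge0 (z - y); have := ler_wpM2r sqz Lc.
set q := edot (z - y) (z - y); set p := grad f y => Lq.
have E v : edot (v - (y - gamma *: p)) (v - (y - gamma *: p)) =
    edot (v - y) (v - y) + 2 * gamma * edot p (v - y) + gamma ^+ 2 * edot p p.
  have -> : v - (y - gamma *: p) = (v - y) + gamma *: p by rewrite opprB addrA addrAC.
  by move: (v - y) => d; rewrite !edotE (edotC d p); ring.
have Ec v : c * edot (v - (y - gamma *: p)) (v - (y - gamma *: p)) =
    c * edot (v - y) (v - y) + edot p (v - y) + c * gamma ^+ 2 * edot p p.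
  rewrite E; transitivity (c * edot (v - y) (v - y) + 2 * (c * gamma) * edot p (v - y)
    + c * gamma ^+ 2 * edot p p); first by ring.
  by rewrite cg divff// mul1r.
rewrite mulrDr !Ec -/q /finobj; lra.
Qed.

(** [prox_grad_le] at [a], where the two objective values compare in the favourable direction. *)
Lemma prox_grad_nonexp y a : argmin (composite f g) a ->
  enorm (prox_grad gamma f g y - a) <= enorm (y - a).
Proof.
move=> ha; apply: ler_enorm_sqr; first exact: enorm_ge0.
have := prox_grad_le y (argmin_lty ha).
have := argmin_finobj_le ha (prox_grad_lty y).
have c0 : 0 < (2 * gamma)^-1 by rewrite invr_gt0 mulr_gt0.
rewrite -!enorm_sqr ![enorm (a - _)]enormB => h1 h2.
rewrite -(ler_pM2l c0); lra.
Qed.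

End ProxGrad.

(** * Energy of an inertial scheme with resets, for an abstract descent map *)

Section InertialEnergy.
Context {R : realType} {n : nat}.
Context (D S : set 'rV[R]_n) (Phi : 'rV[R]_n -> R) (T : 'rV[R]_n -> 'rV[R]_n).
Context (c Fs : R).
Hypothesis c_ge0 : 0 <= c.
Hypothesis T_dom : forall y, D (T y).
Hypothesis T_le : forall y w, D w ->
  Phi (T y) + c * edot (w - T y) (w - T y) <= Phi w + c * edot (w - y) (w - y).
Hypothesis Phi_convex : forall (u v : 'rV[R]_n) (s : R), 0 <= s <= 1 -> D u -> D v ->
  D (s *: u + (1 - s) *: v) /\
  Phi (s *: u + (1 - s) *: v) <= s * Phi u + (1 - s) * Phi v.
Hypothesis S_dom : forall a, S a -> D a.
Hypothesis S_val : forall a, S a -> Phi a = Fs.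
Hypothesis Fs_min : forall w, D w -> Fs <= Phi w.

Lemma energy_step (tau : R) (a x y : 'rV[R]_n)
    (v := x + tau *: (T y - x) - a) (w := x + tau *: (y - x) - a) :
  1 <= tau -> S a -> D x ->
  tau ^+ 2 * (Phi (T y) - Fs) + c * edot v v
  <= (tau ^+ 2 - tau) * (Phi x - Fs) + c * edot w w.
Proof.
move=> tau1 Sa Dx; have tau0 : 0 < tau by lra.
have s01 : 0 <= tau^-1 <= 1 by rewrite invr_ge0 (ltW tau0) invf_le1.
have [Dp] := Phi_convex s01 (S_dom Sa) Dx; rewrite (S_val Sa).
(* This comparison point is chosen so that [tau] times its difference with [z] is, up to sign, the
   vector [x + tau *: (z - x) - a] of the energy. *)
move: Dp; set p := tau^-1 *: a + (1 - tau^-1) *: x => Dp Pp.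
have K z : tau ^+ 2 * edot (p - z) (p - z) =
    edot (x + tau *: (z - x) - a) (x + tau *: (z - x) - a).
  have -> : x + tau *: (z - x) - a = (- tau) *: (p - z).
    by apply/rowP => i; rewrite !mxE; field; rewrite gt_eqF.
  by rewrite !edotE; ring.
have tau20 : 0 < tau ^+ 2 by rewrite exprn_gt0.
have {}Pp : tau ^+ 2 * Phi p <= tau * Fs + (tau ^+ 2 - tau) * Phi x.
  apply: le_trans (ler_wpM2l (ltW tau20) Pp) _.
  by rewrite le_eqVlt; apply/orP; left; apply/eqP; field; rewrite gt_eqF.
have := T_le y Dp; rewrite -(ler_pM2l tau20) !mulrDr !(mulrCA _ c) !K -/v -/w.
lra.
Qed.

Context (t : nat -> R) (x y : nat -> 'rV[R]_n) (acc : nat -> bool).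
Hypothesis t0 : t 0%N = 1.
Hypothesis t_ge1 : forall k, 1 <= t k.
Hypothesis tS : forall k, t k.+1 ^+ 2 - t k.+1 <= t k ^+ 2.
Hypothesis y0 : y 0%N = x 0%N.
Hypothesis yS : forall k, y k.+1 =
  if acc k.+1 then x k.+1 + inertia t k.+1 *: (x k.+1 - x k) else x k.+1.
Hypothesis xS : forall k, x k.+1 = T (y k).

Definition resets k := (\sum_(i < k) ~~ acc i.+1)%N.

Lemma resets_le k : (resets k <= k)%N.
Proof.
rewrite -{2}[k]card_ord -sum1_card; apply: leq_sum => i _; exact: leq_b1.
Qed.

Lemma resets_bounded K0 k : (forall j, (K0 <= j)%N -> acc j.+1) ->
  (resets k <= K0)%N.
Proof.
move=> accP; elim: k => [|k IH]; first by rewrite /resets big_ord0.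
have [K0k|kK0] := leqP K0 k.
  by rewrite /resets big_ord_recr /= accP// addn0.
by apply: leq_trans (resets_le _) kK0.
Qed.

(* An accelerated step keeps the reference minimizer; a reset replaces it by a
   minimizer near the current iterate, which costs at most [c * B]. This is why
   no bound on the whole set of minimizers is needed. *)
Lemma inertial_energy (B : R) xs k : S xs ->
  (forall j, ~~ acc j.+1 -> exists2 a, S a & edot (x j.+1 - a) (x j.+1 - a) <= B) ->
  exists2 a, S a & let v := x k + t k *: (x k.+1 - x k) - a in
    t k ^+ 2 * (Phi (x k.+1) - Fs) + c * edot v v
    <= c * edot (x 0%N - xs) (x 0%N - xs) + (resets k)%:R * (c * B).
Proof.
move=> Sxs HB; elim: k => [|k [a Sa IH]].
  exists xs => //=; rewrite t0 scale1r expr1n mul1r /resets big_ord0 mul0r addr0.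
  rewrite [x 0%N + _]addrC subrK xS.
  have := T_le (y 0%N) (S_dom Sxs); rewrite (S_val Sxs) y0.
  rewrite -(opprB xs) -(opprB xs (x _)) !edotE; lra.
have t1 := t_ge1 k.+1; have Dx : D (x k.+1) by rewrite xS.
have dec : (t k.+1 ^+ 2 - t k.+1) * (Phi (x k.+1) - Fs) <=
    t k ^+ 2 * (Phi (x k.+1) - Fs).
  by rewrite ler_wpM2r// subr_ge0 Fs_min.
rewrite /resets big_ord_recr /= -/(resets k).
have [acck|nacck] := boolP (acc k.+1).
  exists a => //; rewrite addn0; apply: le_trans IH.
  have := energy_step (y k.+1) t1 Sa Dx; rewrite -xS yS acck.
  (* The inertial coefficient satisfies [t k.+1 * inertia t k.+1 = t k - 1], so the quadratic term
     carries over unchanged. *)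
  have -> : x k.+1 + t k.+1 *: (x k.+1 + inertia t k.+1 *: (x k.+1 - x k) - x k.+1) - a
      = x k + t k *: (x k.+1 - x k) - a.
    by apply/rowP => i; rewrite /inertia !mxE/=; field; rewrite gt_eqF//; lra.
  lra.
have [b Sb bB] := HB k nacck.
(* Without acceleration the new quadratic term starts from [x k.+1 - b]; the old one is nonnegative
   and is discarded. *)
exists b => //; have := energy_step (y k.+1) t1 Sb Dx; rewrite -xS yS (negbTE nacck).
rewrite subrr scaler0 addr0 /= natrD (mulrDl _ _ (c * B)) mul1r.
have := ler_wpM2l c_ge0 bB; move: IH => /=.
set v := x k + _ - a; have := mulr_ge0 c_ge0 (edot_ge0 v); lra.
Qed.

Lemma inertial_gap_le (B : R) xs k : S xs ->
  (forall j, ~~ acc j.+1 -> exists2 a, S a & edot (x j.+1 - a) (x j.+1 - a) <= B) ->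
  Phi (x k.+1) - Fs <=
  (c * edot (x 0%N - xs) (x 0%N - xs) + (resets k)%:R * (c * B)) / t k ^+ 2.
Proof.
move=> Sxs HB; have [a Sa] := inertial_energy k Sxs HB.
set v := _ - a => H; have := mulr_ge0 c_ge0 (edot_ge0 v).
have tk : 0 < t k ^+ 2 by rewrite exprn_gt0// (lt_le_trans _ (t_ge1 k)).
rewrite ler_pdivlMr// mulrC; move: H; rewrite /=; lra.
Qed.

(* With coefficients at most 1 this is the usual Lyapunov function of the
   heavy-ball type; resets only help. *)
Lemma gap_le_first k : (forall j, inertia t j.+1 <= 1) ->
  (forall j, 0 <= inertia t j.+1) ->
  Phi (x k.+1) + c * edot (x k.+1 - x k) (x k.+1 - x k)
  <= Phi (x 1%N) + c * edot (x 1%N - x 0%N) (x 1%N - x 0%N).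
Proof.
move=> a1 a0; elim: k => [|k IH]; first exact: lexx.
apply: le_trans IH.
have Dx : D (x k.+1) by rewrite xS.
have := T_le (y k.+1) Dx; rewrite -xS -(opprB (x k.+2)) edotNl edotNr opprK.
move=> H; apply: le_trans H _; rewrite lerD2l ler_wpM2l// yS.
case: ifP => _; last by rewrite subrr -[X in edot X X](scale0r 0) edotZl mul0r edot_ge0.
rewrite opprD addrA subrr add0r; move: (x k.+1 - x k) => d.
rewrite !edotE; move: (edot_ge0 d) (a1 k) (a0 k); set al := inertia t k.+1 => d0 al1 al0.
rewrite mulrN opprK mulrA -[leRHS]mul1r ler_wpM2r//; nra.
Qed.

End InertialEnergy.

(** * Scalar estimates and bounds on the inertial sequence *)

Section RealEstimates.
Context {R : realType}.

(** For [d] above 1 the right-hand side is at most [(A + B) * d], so a superlinear power wins; with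
    [B = 0] linear growth suffices. *)
Lemma powR_le_affine_bounded (beta p A B : R) : 0 < beta -> 1 <= p -> 0 <= A -> 0 <= B ->
  1 < p \/ B = 0 ->
  exists2 M, 0 < M & forall d, 0 <= d -> beta * d `^ p <= A + B * d -> d <= M.
Proof.
move=> beta0 p1 A0 B0 [p1'|->]; last first.
  exists (Num.max 1 (A / beta)) => [|d d0]; first by rewrite lt_max ltr01.
  rewrite mul0r addr0 le_max => H; have [//|d1] := leP d 1.
  rewrite /= ler_pdivlMr// mulrC; apply: le_trans H; rewrite ler_pM2l//.
  by rewrite -{1}(powRr1 d0) ler_powR// ltW.
set K := (A + B) / beta; have K0 : 0 <= K by apply: divr_ge0; [exact: addr_ge0|exact: ltW].
exists (Num.max 1 (K `^ (p - 1)^-1)) => [|d d0]; first by rewrite lt_max ltr01.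
rewrite le_max => H; have [//|d1] := leP d 1; have dp : 0 < d by lra.
have pp : 0 < p - 1 by rewrite subr_gt0.
have dK : d `^ (p - 1) <= K.
  have E : d `^ p = d * d `^ (p - 1).
    rewrite -{2}(powRr1 d0) -powRD; first by rewrite addrC subrK.
    by rewrite (gt_eqF dp) implybT.
  rewrite ler_pdivlMr// -(ler_pM2l dp); apply: le_trans (_ : beta * d `^ p <= _).
    by rewrite E le_eqVlt; apply/orP; left; apply/eqP; ring.
  by apply: le_trans H _; nra.
apply/orP; right.
have -> : d = (d `^ (p - 1)) `^ (p - 1)^-1 by rewrite -powRrM divff ?powRr1// lt0r_neq0.
by apply: ge0_ler_powR; rewrite ?nnegrE ?powR_ge0// invr_ge0 ltW.
Qed.

Lemma bigO_natP (h e : nat -> R) (k : R) :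
  (forall m, (1 <= m)%N -> 0 <= h m <= k * e m) ->
  (h : nat -> R^o) =O_\oo (e : nat -> R^o).
Proof.
move=> H; apply/eqO_exP; exists (`|k| + 1); first by rewrite ltr_wpDl.
exists 1%N => // m /= m1; have /andP[h0 hk] := H m m1.
rewrite ger0_norm//; apply: le_trans hk _; apply: le_trans (ler_norm _) _.
by rewrite normrM ler_wpM2r// lerDl.
Qed.

Context (t : nat -> R).
Hypothesis t0 : t 0%N = 1.
Hypothesis tS : forall k, t k.+1 ^+ 2 - t k.+1 <= t k ^+ 2.

Lemma inertia_t_ge1 (C : R) : 0 < C -> (forall k, C * k%:R <= t k) ->
  (forall k, 0 <= inertia t k.+1) -> forall k, 1 <= t k.
Proof.
move=> C0 tC al0 k; have := al0 k; rewrite /inertia /= pmulr_lge0 ?subr_ge0//.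
by rewrite invr_gt0; apply: lt_le_trans (tC _); rewrite mulr_gt0.
Qed.

(** The recursion forbids growth by more than 1: beyond [t k + 1], the product of [t k.+1] and
    [t k.+1 - 1] would exceed [t k ^+ 2]. *)
Lemma inertia_t_le : (forall k, 1 <= t k) -> forall k, t k <= k.+1%:R.
Proof.
move=> t1; elim => [|k IH]; first by rewrite t0.
have := t1 k; have := t1 k.+1; have := tS k; rewrite -[k.+2%:R]natr1.
move=> H1 H2 H3; rewrite leNgt; apply/negP => H4; nra.
Qed.

Lemma inertia_le (C : R) : 0 < C -> (forall k, C * k%:R <= t k) ->
  (forall k, 1 <= t k) -> forall k, inertia t k.+1 <= C^-1.
Proof.
move=> C0 tC t1 k; rewrite /inertia /= ler_pdivrMr; last by have := t1 k.+1; lra.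
apply: le_trans (_ : C^-1 * (C * k.+1%:R) <= _); last by rewrite ler_pM2l ?invr_gt0.
rewrite mulKf ?gt_eqF//; have := inertia_t_le t1 k; lra.
Qed.

End RealEstimates.

(** * Distance to a set *)

Section Distance.
Context {R : realType} {n : nat}.
Implicit Types (x : 'rV[R]_n) (S : set 'rV[R]_n).

Lemma set_dist_ge0 x S : S !=set0 -> 0 <= set_dist x S.
Proof.
move=> [b Sb]; apply: lb_le_inf; first by exists (enorm (x - b)), b.
by move=> _ [a _ <-]; exact: enorm_ge0.
Qed.

Lemma set_dist1 x a : set_dist x [set a] = enorm (x - a).
Proof. by rewrite /set_dist image_set1 inf1. Qed.

Lemma set_dist_near x S : S !=set0 ->
  exists2 a, S a & enorm (x - a) <= set_dist x S + 1.
Proof.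
move=> [b Sb]; have [] := @inf_adherent R [set enorm (x - a) | a in S] 1 ltr01.
  split; first by exists (enorm (x - b)), b.
  by exists 0 => _ [a _ <-]; exact: enorm_ge0.
by move=> _ [a Sa <-] H; exists a => //; exact: ltW.
Qed.

End Distance.

(** * Resets, convergence and identification for the algorithm *)

Section ProvisionalApg.
Context {R : realType} {n : nat} (f : 'rV[R]_n -> R) (g : 'rV[R]_n -> \bar R).
Context (L gamma : R).
Hypothesis f_conv : convex_function [set: convex_lmodType 'rV[R]_n] f.
Hypothesis f_diff : forall x, differentiable (f : 'rV[R]_n -> R^o) x.
Hypothesis f_lip : lipschitz_grad L f.
Hypothesis L_gt0 : 0 < L.
Hypothesis g_proper : proper_fun g.
Hypothesis g_conv : econvex g.
Hypothesis g_lsc : lower_semicontinuous g.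
Hypothesis gamma_gt0 : 0 < gamma.
Hypothesis gamma_le : gamma <= 1 / L.

Let F := composite f g.
Let T := prox_grad gamma f g.
Let Phi := finobj f g.
Let c := (2 * gamma)^-1.

Context (xs : 'rV[R]_n).
Hypothesis xs_min : argmin F xs.

Let F_argmin : argmin F !=set0. Proof. by exists xs. Qed.

Let c_gt0 : 0 < c. Proof. by rewrite invr_gt0 mulr_gt0. Qed.

Let T_lty v : (g (T v) < +oo)%E.
Proof. by apply: (@prox_grad_lty _ _ _ _ L). Qed.

Let T_le v w : (g w < +oo)%E ->
  Phi (T v) + c * edot (w - T v) (w - T v) <= Phi w + c * edot (w - v) (w - v).
Proof. by apply: (@prox_grad_le _ _ _ _ L). Qed.

Let T_near v : enorm (T v - xs) <= enorm (v - xs).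
Proof. by apply: (@prox_grad_nonexp _ _ _ _ L). Qed.

Context (beta p : R).
Hypothesis beta_gt0 : 0 < beta.
Hypothesis p_ge1 : 1 <= p.
Hypothesis F_eb : error_bound F beta p.

Lemma finobj_error_bound w : (g w < +oo)%E ->
  beta * set_dist w (argmin F) `^ p <= Phi w - Phi xs.
Proof.
move=> gw; have := F_eb w.
by rewrite (ereal_inf_argmin g_proper xs_min) [F w]compositeE// -EFinB lee_fin.
Qed.

Context (t : nat -> R) (zeta : R) (N : nat) (M : 'I_N -> set 'rV[R]_n).
Context (x0 : 'rV[R]_n) (x y u : nat -> 'rV[R]_n).
Let alpha := inertia t.
Let acc k := test2 gamma f g alpha zeta M k x y.
Hypothesis t0 : t 0%N = 1.
Hypothesis tS : forall k, t k.+1 ^+ 2 - t k.+1 <= t k ^+ 2.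
Hypothesis t_ge1 : forall k, 1 <= t k.
Hypothesis alpha_ge0 : forall k, 0 <= alpha k.+1.
Hypothesis xy_apg :
  provisional_apg gamma f g alpha (test2 gamma f g alpha zeta M) x0 x y u.

Let x_0 : x 0%N = x0. Proof. by case: xy_apg. Qed.

Let y_0 : y 0%N = x 0%N. Proof. by case: xy_apg => -> ->. Qed.

Let yS k : y k.+1 =
  if acc k.+1 then x k.+1 + alpha k.+1 *: (x k.+1 - x k) else x k.+1.
Proof. by case: xy_apg. Qed.

Let xS k : x k.+1 = T (y k).
Proof. by case: xy_apg => _ _ _ uE ->; rewrite uE. Qed.

Let x_lty k : (g (x k.+1) < +oo)%E. Proof. by rewrite xS. Qed.

Lemma reset_zone k : ~~ acc k.+1 ->
  enorm (x k.+1 - y k) ^+ 2 <= zeta /\ (F (x k.+1) <= F x0)%E.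
Proof. by rewrite negbK => /asboolP[]; rewrite /test2_zone /= xS x_0. Qed.

(** In [T_le] at [a] the squared distances from [a] to [y k] and to [x k.+1] nearly cancel, since
    these points are within the root of [zeta]. What remains is only linear in the distance, which
    matters when [F x0] is infinite. *)
Lemma reset_gap_le k a : 0 <= zeta -> ~~ acc k.+1 -> (argmin F) a ->
  Phi (x k.+1) - Phi xs <=
  c * (2 * Num.sqrt zeta * enorm (x k.+1 - a) + Num.sqrt zeta ^+ 2).
Proof.
move=> zeta0 /reset_zone[xy _] a_min.
have ga := argmin_lty g_proper a_min.
have -> : Phi xs = Phi a by exact: finobj_argmin.
have := T_le (y k) ga; rewrite -xS.
have {xy} : enorm (x k.+1 - y k) <= Num.sqrt zeta.
  by apply: ler_enorm_sqr; rewrite ?sqrtr_ge0// sqr_sqrtr// -enorm_sqr.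
have := ler_enorm_distD (x k.+1) a (y k); rewrite (enormB a (x k.+1)) -!enorm_sqr.
rewrite (enormB a (x k.+1)).
have := enorm_ge0 (a - y k); have := enorm_ge0 (x k.+1 - a).
set d := enorm (x k.+1 - a); set e := enorm (a - y k).
set s := Num.sqrt zeta => d0 e0 tri xy H.
have e2 : e ^+ 2 <= (d + s) ^+ 2 by rewrite ler_pXn2r ?nnegrE//; lra.
have := ler_wpM2l (ltW c_gt0) e2; lra.
Qed.

(* Three ways of bounding the distance to the minimizers at a reset: by the
   sublevel of [x0]; by [zeta] and the superlinear growth of the error bound; or
   by the monotone Lyapunov function when the inertia is at most 1. *)
Lemma reset_dist_bounded : 0 <= zeta ->
  [\/ (F x0 < +oo)%E, 1 < p | forall k, alpha k.+1 <= 1] ->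
  exists2 B, 0 < B &
    forall k, ~~ acc k.+1 -> set_dist (x k.+1) (argmin F) <= B.
Proof.
move=> zeta0 [Fx0|p1|a1].
- have gx0 : (g x0 < +oo)%E by rewrite -(composite_lty f).
  have gap0 : 0 <= Phi x0 - Phi xs by rewrite subr_ge0; exact: argmin_finobj_le.
  have [|B B0 HB] := powR_le_affine_bounded beta_gt0 p_ge1 gap0 (lexx 0); first by right.
  exists B => // k acck; apply: HB; first exact: set_dist_ge0.
  apply: le_trans (finobj_error_bound (x_lty k)) _.
  rewrite mul0r addr0 lerD2r; have [_] := reset_zone acck.
  by rewrite /F !compositeE.
- set s := Num.sqrt zeta; have s0 : 0 <= s by exact: sqrtr_ge0.
  have A0 : 0 <= c * (2 * s + s ^+ 2).
    by rewrite mulr_ge0 ?(ltW c_gt0)// addr_ge0 ?sqr_ge0// mulr_ge0.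
  have B'0 : 0 <= c * (2 * s) by rewrite mulr_ge0 ?(ltW c_gt0)// mulr_ge0.
  have [|B B0 HB] := powR_le_affine_bounded beta_gt0 p_ge1 A0 B'0; first by left.
  exists B => // k acck; apply: HB; first exact: set_dist_ge0.
  apply: le_trans (finobj_error_bound (x_lty k)) _.
  have [a a_min xa] := set_dist_near (x k.+1) F_argmin.
  apply: le_trans (reset_gap_le zeta0 acck a_min) _.
  have := ler_wpM2l B'0 xa; rewrite -/s; lra.
- set A := Phi (x 1%N) + c * edot (x 1%N - x 0%N) (x 1%N - x 0%N) - Phi xs.
  have first k : Phi (x k.+1) - Phi xs <= A.
    have := @gap_le_first _ _ (fun w => g w < +oo)%E Phi T c (ltW c_gt0) T_lty T_le
      t x y acc yS xS k a1 alpha_ge0.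
    have := mulr_ge0 (ltW c_gt0) (edot_ge0 (x k.+1 - x k)).
    rewrite /A; lra.
  have A0 : 0 <= A.
    by apply: le_trans (first 0%N); rewrite subr_ge0; exact: argmin_finobj_le.
  have [|B B0 HB] := powR_le_affine_bounded beta_gt0 p_ge1 A0 (lexx 0); first by right.
  exists B => // k _; apply: HB; first exact: set_dist_ge0.
  by apply: le_trans (finobj_error_bound (x_lty k)) _; rewrite mul0r addr0.
Qed.

Lemma apg_gap_le : 0 <= zeta ->
  [\/ (F x0 < +oo)%E, 1 < p | forall k, alpha k.+1 <= 1] ->
  exists2 B, 0 < B & forall k, Phi (x k.+1) - Phi xs <=
    enorm (x0 - xs) ^+ 2 / (2 * gamma * t k ^+ 2)
    + (resets acc k)%:R * B / (2 * gamma * t k ^+ 2).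
Proof.
move=> zeta0 /(reset_dist_bounded zeta0)[B B0 HB].
(* The added 1 is the slack of [set_dist_near], which picks a minimizer almost realizing the
   distance. *)
exists ((B + 1) ^+ 2) => [|k]; first by rewrite exprn_gt0// addr_gt0.
apply: le_trans (_ : (c * edot (x 0%N - xs) (x 0%N - xs)
    + (resets acc k)%:R * (c * (B + 1) ^+ 2)) / t k ^+ 2 <= _).
  apply: (@inertial_gap_le _ _ (fun w => g w < +oo)%E (argmin F) Phi T c (Phi xs)
    (ltW c_gt0) T_lty T_le _ _ _ _ t x y) => //.
  - by move=> v w s s01; exact: finobj_convex.
  - by move=> a; exact: argmin_lty.
  - by move=> a a_min; exact: finobj_argmin.
  - by move=> w; exact: argmin_finobj_le.
  - move=> j /HB xB; have [a a_min xa] := set_dist_near (x j.+1) F_argmin.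
    exists a => //; rewrite -enorm_sqr ler_pXn2r ?nnegrE ?enorm_ge0//; lra.
rewrite x_0 -enorm_sqr /c le_eqVlt; apply/orP; left; apply/eqP.
have tk : t k != 0 by have := t_ge1 k => tk; rewrite gt_eqF//; lra.
by field; rewrite tk gt_eqF.
Qed.

Hypothesis xs_unique : argmin F = [set xs].

Lemma apg_cvg (Q : R) :
  (forall k, (1 <= k)%N -> Phi (x k.+1) - Phi xs <= Q * k%:R^-1) -> x @ \oo --> xs.
Proof.
move=> gap; rewrite -cvg_shiftS; apply/enorm_cvgP => e e0.
have ep0 : 0 < beta * e `^ p by rewrite mulr_gt0// powR_gt0.
have p0 : 0 < p by exact: lt_le_trans p_ge1.
near=> k; have k0 : (1 <= k)%N by near: k; exact: nbhs_infty_ge.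
rewrite ltNge; apply/negP => ex.
have := finobj_error_bound (x_lty k); rewrite xs_unique set_dist1.
apply/negP; rewrite -ltNge; apply: le_lt_trans (gap _ k0) _.
apply: lt_le_trans (_ : beta * e `^ p <= _); last first.
  by rewrite ler_pM2l//; apply: ge0_ler_powR; rewrite ?nnegrE ?enorm_ge0 ?(ltW p0) ?(ltW e0).
rewrite ltr_pdivrMr ?ltr0n// -ltr_pdivrMl// mulrC.
by near: k; exact: nbhs_infty_gtr.
Unshelve. all: by end_near. Qed.

Lemma accel_cvg (C : R) : 0 < C -> (forall k, C * k%:R <= t k) -> x @ \oo --> xs ->
  (fun k => x k.+1 + alpha k.+1 *: (x k.+1 - x k)) @ \oo --> xs.
Proof.
move=> C0 tC xxs; apply/enorm_cvgP => e e0.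
(* The inertial coefficients are at most [C^-1], so the total error is below [d + C^-1 * (d + d)],
   which is [e]. *)
pose d := e / (1 + 2 * C^-1).
have D0 : 0 < 1 + 2 * C^-1 by rewrite addr_gt0// mulr_gt0// invr_gt0.
have d0 : 0 < d by rewrite divr_gt0.
have xS_xs : (fun k => x k.+1) @ \oo --> xs by rewrite cvg_shiftS.
have xd := (enorm_cvgP _ _).1 xxs _ d0.
have xSd := (enorm_cvgP _ _).1 xS_xs _ d0.
near=> k.
have xk : enorm (x k - xs) < d by near: k; exact: xd.
have xSk : enorm (x k.+1 - xs) < d by near: k; exact: xSd.
have -> : x k.+1 + alpha k.+1 *: (x k.+1 - x k) - xs =
    (x k.+1 - xs) + alpha k.+1 *: (x k.+1 - x k) by rewrite addrAC.
apply: le_lt_trans (ler_enormD _ _) _; rewrite enormZ ger0_norm//.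
have -> : e = d + C^-1 * (d + d) by rewrite -[LHS](divfK (lt0r_neq0 D0)) -/d; ring.
apply: ltr_leD => //; apply: ler_pM; rewrite ?enorm_ge0//.
  exact: (@inertia_le _ t).
apply: le_trans (ler_enorm_distD xs _ _) _; rewrite (enormB xs); lra.
Unshelve. all: by end_near. Qed.

Hypothesis M_closed : forall i, closed (M i).
Hypothesis M_qualif : forall i, M i xs ->
  exists2 eps : R, 0 < eps &
    forall w, eball (xs - gamma *: grad f xs) eps w -> M i (prox gamma g w).

(** If [xs] lies in [M i], the gradient step is Lipschitz with constant [1 + gamma * L] and ends in
    the qualifying ball. Otherwise the images converge to [xs] and enter the open complement of
    [M i]. *)
Lemma prox_grad_identifies (s : nat -> 'rV[R]_n) i : s @ \oo --> xs ->
  \forall k \near \oo, M i (T (s k)) <-> M i xs.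
Proof.
move=> sxs; have [Mi|nMi] := pselect (M i xs).
  have [eps eps0 Meps] := M_qualif Mi.
  have G0 : 0 < 1 + gamma * L by rewrite addr_gt0// mulr_gt0.
  have e0 : 0 < eps / (1 + gamma * L) by rewrite divr_gt0.
  apply: filterS ((enorm_cvgP s xs).1 sxs _ e0) => k sk.
  split=> // _; apply: Meps; rewrite /eball /=.
  have -> : s k - gamma *: grad f (s k) - (xs - gamma *: grad f xs) =
      (s k - xs) + (- gamma) *: (grad f (s k) - grad f xs).
    by apply/rowP => j; rewrite !mxE; ring.
  apply: le_lt_trans (ler_enormD _ _) _; rewrite enormZ normrN gtr0_norm//.
  rewrite ltr_pdivlMr// in sk; apply: le_lt_trans sk.
  by rewrite mulrDr mulr1 lerD2l mulrCA ler_pM2l// [leRHS]mulrC f_lip.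
have : (fun k => T (s k)) @ \oo --> xs.
  apply/enorm_cvgP => e e0; have se := (enorm_cvgP s xs).1 sxs _ e0.
  by near=> k; apply: le_lt_trans (T_near _) _; near: k; exact: se.
have nM : nbhs xs (~` M i) by apply: open_nbhs_nbhs; split=> //; exact: closed_openC.
move=> /(_ _ nM) nT.
have {}nT : \forall k \near \oo, ~ M i (T (s k)) by exact: nT.
by apply: filterS nT => k nTk; split.
Unshelve. all: by end_near. Qed.

Lemma apg_identifies (C : R) : 0 < C -> (forall k, C * k%:R <= t k) ->
  x @ \oo --> xs ->
  exists K0 : nat, (forall k, (K0 <= k)%N -> forall i, M i (x k) <-> M i xs) /\
    forall k, (K0 <= k)%N -> acc k.+1.
Proof.
move=> C0 tC xxs.
have xS_xs : (fun k => x k.+1) @ \oo --> xs by rewrite cvg_shiftS.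
have wxs := accel_cvg C0 tC xxs.
have yxs : y @ \oo --> xs.
  rewrite -cvg_shiftS; apply/enorm_cvgP => e e0.
  have we := (enorm_cvgP _ _).1 wxs _ e0; have xe := (enorm_cvgP _ _).1 xS_xs _ e0.
  near=> k; rewrite /= yS; case: ifP => _; near: k; [exact: we|exact: xe].
have [K1 _ H1] := filter_forall _ (fun i => prox_grad_identifies i yxs).
have [K2 _ H2] := filter_forall _ (fun i => prox_grad_identifies i xS_xs).
have [K3 _ H3] := filter_forall _ (fun i => prox_grad_identifies i wxs).
(* The successor covers the shift in [x k.+1 = T (y k)]. The test compares [T] at [x k.+1] and at
   the extrapolated point; both now lie in the same sets. *)
exists (K1 + K2 + K3).+1; split=> k.
  case: k => // k; rewrite ltnS => kK i; rewrite xS; apply: H1 => /=.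
  by apply: leq_trans kK; rewrite -addnA leq_addr.
move=> /ltnW kK; apply/negP => /asboolP[_ [i [Mi nMi]]]; apply: nMi.
apply/(H3 k) => /=; first by apply: leq_trans kK; rewrite leq_addl.
apply/(H2 k) => //=; apply: leq_trans kK.
by rewrite addnAC leq_addl.
Unshelve. all: by end_near. Qed.

End ProvisionalApg.

(** * Explicit rates and assembly *)

Lemma inv_sqr_rate {R : realType} (gamma C K t : R) (k : nat) : 0 < gamma -> 0 < C ->
  0 <= K -> (1 <= k)%N -> C * k%:R <= t ->
  0 <= K / (2 * gamma * t ^+ 2) <= K / (2 * gamma * C ^+ 2) * (k%:R ^+ 2)^-1.
Proof.
move=> gamma0 C0 K0 k1 Ct; have Ck : 0 < C * k%:R by rewrite mulr_gt0// ltr0n.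
have t0 : 0 < t by exact: lt_le_trans Ct.
have g0 : 0 < 2 * gamma by rewrite mulr_gt0.
apply/andP; split; first by rewrite divr_ge0// mulr_ge0 ?sqr_ge0// ltW.
rewrite -[leRHS]mulrA -invfM -(mulrA _ (C ^+ 2)) -exprMn ler_wpM2l//.
rewrite lef_pV2 ?posrE ?(mulr_gt0 g0) ?exprn_gt0//.
by rewrite ler_pM2l// ler_pXn2r ?nnegrE ?(ltW Ck) ?(ltW t0).
Qed.

Unset Implicit Arguments.

Theorem theorem3p2 (R : realType) (n : nat)
    (f : 'rV[R]_n -> R) (g : 'rV[R]_n -> \bar R) (L : R)
    (F := composite f g) (Fstar := ereal_inf (range F))
    (hL : 0 < L)
    (hfconv : convex_function [set: convex_lmodType 'rV[R]_n] f)
    (hfdiff : forall x, differentiable (f : 'rV[R]_n -> R^o) x)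
    (hflip : lipschitz_grad L f)
    (hgproper : proper_fun g) (hgconv : econvex g) (hglsc : lower_semicontinuous g)
    (hargmin : argmin F !=set0)
    (t : nat -> R) (alpha := inertia t)
    (ht0 : t 0%N = 1)
    (htS : forall k, t k.+1 ^+ 2 - t k.+1 <= t k ^+ 2)
    (htC : exists2 C : R, 0 < C & forall k, C * k%:R <= t k)
    (halpha : forall k, 0 <= alpha k.+1)
    (beta p : R) (hbeta : 0 < beta) (hp : 1 <= p) (heb : error_bound F beta p)
    (gamma : R) (hgamma0 : 0 < gamma) (hgammaL : gamma <= 1 / L)
    (zeta : R) (hzeta : 0 < zeta)
    (r : option nat) (hr : r != Some 0%N)
    (N : nat) (M : 'I_N -> set 'rV[R]_n)
    (hMclosed : forall i, closed (M i))
    (hMmanifold : forall i, submanifold r (M i))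
    (x0 : 'rV[R]_n) (x y u : nat -> 'rV[R]_n)
    (halgo : provisional_apg gamma f g alpha
               (test2 gamma f g alpha zeta M) x0 x y u)
    (* Superfluous unless F x0 = +oo and p = 1 and (t_k) decreases somewhere by
       more than 1; in that case the rate can fail. *)
    (hx0 : [\/ (F x0 < +oo)%E, 1 < p | forall k, alpha k.+1 <= 1]) :
  forall xs, argmin F xs ->
  exists2 RR : R, 0 < RR &
    ((forall m, (1 <= m)%N ->
        (F (x m.+1) - Fstar <=
           (enorm (x0 - xs) ^+ 2 / (2 * gamma * t m ^+ 2)
            + m%:R * RR / (2 * gamma * t m ^+ 2))%:E)%E)
     /\ (fun m => enorm (x0 - xs) ^+ 2 / (2 * gamma * t m ^+ 2)
            + m%:R * RR / (2 * gamma * t m ^+ 2) : R^o)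
          =O_\oo (fun m => m%:R^-1 : R^o))
    /\
    (let us := xs - gamma *: grad f xs in
     argmin F = [set xs] ->
     (forall i, M i xs ->
        exists2 eps : R, 0 < eps &
          forall w, eball us eps w -> M i (prox gamma g w)) ->
     [/\ x @ \oo --> xs,
         (exists K0 : nat, forall k, (K0 <= k)%N ->
            forall i, M i (x k) <-> M i xs) &
         exists2 K : R, 0 < K &
           (forall m, (1 <= m)%N ->
              (F (x m.+1) - Fstar <=
                 (enorm (x0 - xs) ^+ 2 / (2 * gamma * t m ^+ 2)
                  + K * RR / (2 * gamma * t m ^+ 2))%:E)%E)
           /\ (fun m => enorm (x0 - xs) ^+ 2 / (2 * gamma * t m ^+ 2)
                  + K * RR / (2 * gamma * t m ^+ 2) : R^o)
                =O_\oo (fun m => (m%:R ^+ 2)^-1 : R^o)]).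
Proof.
move=> xs xs_min.
case: (htC) => C C0 tC.
have t1 := inertia_t_ge1 C0 tC halpha.
have c0 : 0 < 2 * gamma by rewrite mulr_gt0.
have [B B0 gap] := apg_gap_le hfconv hfdiff hflip hL hgproper hgconv hglsc hgamma0
  hgammaL xs_min hbeta hp heb ht0 htS t1 halpha halgo (ltW hzeta) hx0.
set acc := fun k => test2 gamma f g alpha zeta M k x y.
have FE m : (F (x m.+1) - Fstar)%E = (finobj f g (x m.+1) - finobj f g xs)%:E.
  rewrite /Fstar (ereal_inf_argmin hgproper xs_min) [F _]compositeE//.
  case: halgo => _ _ _ uE ->; rewrite uE.
  by apply: (@prox_grad_lty _ _ _ _ L).
set A := enorm (x0 - xs) ^+ 2; have A0 : 0 <= A by exact: sqr_ge0.
(* Both rates come from here: [K] is [m] in general, and a constant once resets have stopped. *)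
have gap_resets (K : R) m : (resets acc m)%:R <= K ->
    finobj f g (x m.+1) - finobj f g xs <=
    A / (2 * gamma * t m ^+ 2) + K * B / (2 * gamma * t m ^+ 2).
  move=> mK; apply: le_trans (gap m) _; rewrite lerD2l.
  rewrite ler_pM2r ?ler_pM2r// invr_gt0 mulr_gt0// exprn_gt0//.
  exact: lt_le_trans (t1 m).
have gap_linear m : finobj f g (x m.+1) - finobj f g xs <=
    A / (2 * gamma * t m ^+ 2) + m%:R * B / (2 * gamma * t m ^+ 2).
  by apply: gap_resets; rewrite ler_nat resets_le.
have lin_rate m : (1 <= m)%N ->
    0 <= A / (2 * gamma * t m ^+ 2) + m%:R * B / (2 * gamma * t m ^+ 2)
      <= (A + B) / (2 * gamma * C ^+ 2) * m%:R^-1.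
  move=> m1; have m0 : 0 < m%:R :> R by rewrite ltr0n.
  have K0 : 0 <= A + m%:R * B by rewrite addr_ge0// mulr_ge0// ltW.
  rewrite -mulrDl; have /andP[-> /=] := inv_sqr_rate hgamma0 C0 K0 m1 (tC m).
  move=> H; apply: le_trans H _.
  have -> : (A + B) / (2 * gamma * C ^+ 2) * m%:R^-1 =
      (m%:R * (A + B)) / (2 * gamma * C ^+ 2) * (m%:R ^+ 2)^-1.
    by field; rewrite !gt_eqF.
  rewrite !ler_pM2r ?invr_gt0 ?mulr_gt0 ?exprn_gt0//.
  by rewrite mulrDr lerD2r ler_peMl// ler1n.
exists B => //; split; first split.
- by move=> m _; rewrite FE lee_fin; exact: gap_linear.
- exact: bigO_natP lin_rate.
move=> us xs_unique qualif.
have xxs : x @ \oo --> xs.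
  apply: (apg_cvg hfdiff hflip hgproper hgconv hglsc hgamma0 xs_min hbeta hp heb halgo
    xs_unique (Q := (A + B) / (2 * gamma * C ^+ 2))).
  move=> k k1; apply: le_trans (gap_linear k) _.
  by have /andP[] := lin_rate k k1.
have [K0 [ident accK0]] := apg_identifies hfconv hfdiff hflip hL hgproper hgconv hglsc
  hgamma0 hgammaL xs_min ht0 htS t1 halpha halgo hMclosed qualif C0 tC xxs.
split=> //; first by exists K0.
(* At most [K0] resets occur; the successor makes the constant positive. *)
exists K0.+1%:R => //; split.
  move=> m _; rewrite FE lee_fin; apply: gap_resets.
  by rewrite ler_nat leqW// (@resets_bounded acc).
apply: (@bigO_natP _ _ _ ((A + K0.+1%:R * B) / (2 * gamma * C ^+ 2))) => m m1.
rewrite -mulrDl; apply: inv_sqr_rate => //.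
by rewrite addr_ge0// mulr_ge0// ltW.
Qed.
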